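(* Fix an integer $k\ge 2$. For each $n\in\mathbb{N}$, let $I_{k,n}$ be the number of subsets of $\{1,2,\ldots,n\}$ that (1) satisfy the $k$-Zeckendorf condition, (2) contain $n$, and (3) are strong-Schreier. Then $$I_{k,n}=\begin{cases}0, & \text{if } n=1;\\ 1, & \text{if } 2\le n\le k+2;\\ I_{k,n-1}+I_{k,n-(k+1)}, & \text{if } n>k+2.\end{cases}$$
   Context: $\mathbb{N}=\{1,2,3,\ldots\}$. A nonempty finite set $S\subseteq\mathbb{N}$ is strong-Schreier if $\min S> |S|$. A finite set of natural numbers satisfies the $k$-Zeckendorf condition if any two distinct numbers in the set are at least $k$ apart (singletons satisfy this vacuously). *)

(* Defs.v *)
From mathcomp Require Import all_boot finmap.

Set Implicit Arguments.
Unset Strict Implicit.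
Unset Printing Implicit Defensive.

Local Open Scope fset_scope.
Local Open Scope nat_scope.

(* The value on the empty set, 0, is a dummy. *)
Definition min_fset (S : {fset nat}) : nat := head 0 (sort leq (enum_fset S)).

Definition strong_schreier (S : {fset nat}) : bool :=
  (S != fset0) && (min_fset S > #|` S|).

(* Truncated subtraction is exact here; by symmetry it suffices to compare
   the pairs with x < y. *)
Definition zeckendorf (k : nat) (S : {fset nat}) : bool :=
  [forall x : S, forall y : S, (val x < val y) ==> (k <= val y - val x)].

Definition interval1 (n : nat) : {fset nat} := [fset i in iota 1 n].

Definition I_count (k n : nat) : nat :=
  #|` [fset S in fpowerset (interval1 n)
       | [&& zeckendorf k S, n \in S & strong_schreier S]] |.

(* Main.v *)
(* Write s for the size and m for the minimum of an admissible set S with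
   maximum n, so that m > s.  If m > s + 1, translating S by -1 gives an
   admissible set with maximum n - 1.  If m = s + 1, deleting m and translating
   by -(k + 1) gives an admissible set with maximum n - (k + 1): the next element
   of S is at least s + 1 + k, hence lands above s - 1.  Both operations are
   bijective onto the admissible sets of the smaller maximum. *)
Require Import Defs.
From mathcomp Require Import all_boot.
From mathcomp Require Import finmap zify.

Set Implicit Arguments.
Unset Strict Implicit.
Unset Printing Implicit Defensive.

Local Open Scope fset_scope.
Local Open Scope nat_scope.

(** Turns the minimum into a bound on every element, the only form used later. Nonemptiness rules
    out the dummy value of [head]. *)
Lemma ltn_min_fset m (S : {fset nat}) : S != fset0 ->
  reflect (forall x, x \in S -> m < x) (m < min_fset S).
Proof.
move=> S0; rewrite /min_fset.
have mem_s x : (x \in sort leq (enum_fset S)) = (x \in S) by rewrite mem_sort.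
have : sorted leq (sort leq (enum_fset S)) by apply: sort_sorted; apply: leq_total.
case: (sort _ _) mem_s => [|y s] mem_s /= y_s.
  by exfalso; case/fset0Pn: S0 => x; rewrite -mem_s.
apply: (iffP idP) => [m_y x|]; last by apply; rewrite -mem_s mem_head.
rewrite -mem_s inE => /orP[/eqP->//|x_s].
by apply: leq_trans m_y _; have /allP := order_path_min leq_trans y_s; apply.
Qed.

Lemma zeckendorfP k (S : {fset nat}) :
  reflect {in S &, forall x y, x < y -> k <= y - x} (zeckendorf k S).
Proof.
apply: (iffP forallP) => [H x y xS yS xy|H x].
  by have /forallP/(_ [` yS])/implyP := H [` xS]; apply.
by apply/forallP => y; apply/implyP; apply: H; apply: valP.
Qed.

Definition admissible k n : {fset {fset nat}} :=
  [fset S in fpowerset (interval1 n)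
   | [&& zeckendorf k S, n \in S & strong_schreier S]].

(** Nonemptiness is carried by [n \in S], and positivity of the elements by the strict bound from
    the size. *)
Lemma admissibleP k n (S : {fset nat}) :
  reflect [/\ {in S &, forall x y, x < y -> k <= y - x}, n \in S,
              {in S, forall x, x <= n} & {in S, forall x, #|` S| < x}]
          (S \in admissible k n).
Proof.
rewrite !inE /= fpowersetE; apply: (iffP idP).
  case/and4P=> /fsubsetP Sn /zeckendorfP Sk nS /andP[S0 /(ltn_min_fset _ S0) Ss].
  split=> // x /Sn; rewrite !inE /= mem_iota; lia.
case=> Sk nS Sn Ss; have S0 : S != fset0 by apply/fset0Pn; exists n.
apply/and4P; split=> //; last by apply/andP; split=> //; apply/ltn_min_fset.
- apply/fsubsetP => x xS; rewrite !inE /= mem_iota.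
  by have := Sn x xS; have := Ss x xS; lia.
- exact/zeckendorfP.
Qed.

Definition shift d (S : {fset nat}) : {fset nat} := [fset x + d | x in S].

Definition unshift d (S : {fset nat}) : {fset nat} := [fset x - d | x in S].

Lemma mem_shift d (S : {fset nat}) x :
  (x \in shift d S) = (d <= x) && (x - d \in S).
Proof.
apply/imfsetP/andP => /= [[y yS ->]|[dx xS]]; first by rewrite leq_addl addnK.
by exists (x - d); rewrite ?subnK.
Qed.

Lemma card_shift d (S : {fset nat}) : #|` shift d S| = #|` S|.
Proof. by rewrite card_imfset //=; apply: addIn. Qed.

Lemma shiftK d : cancel (shift d) (unshift d).
Proof.
move=> S; apply/fsetP => x; apply/imfsetP/idP => /= [[y]|xS].
  by rewrite mem_shift => /andP[_ ?] ->.
by exists (x + d); rewrite ?mem_shift ?addnK ?leq_addl.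
Qed.

Lemma unshiftK d (S : {fset nat}) :
  {in S, forall x, d <= x} -> shift d (unshift d S) = S.
Proof.
move=> dS; apply/fsetP => x; rewrite mem_shift; apply/andP/idP.
  case=> dx /imfsetP[y /= yS eq_xy]; have dy := dS y yS.
  by have -> : x = y by lia.
by move=> xS; split; [apply: dS | apply/imfsetP; exists x].
Qed.

(** The result is meant to have [#|] T| + 1[elements, so]#|[T| + 2] is the least minimum that
    strong-Schreier allows. *)
Definition extend k (T : {fset nat}) : {fset nat} :=
  (#|` T| + 2) |` shift k.+1 T.

Lemma extend_notin k n (T : {fset nat}) : 0 < k ->
  T \in admissible k n -> #|` T| + 2 \notin shift k.+1 T.
Proof.
move=> k0 /admissibleP[_ _ _ Ts]; rewrite mem_shift; apply/negP => /andP[? /Ts].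
lia.
Qed.

Lemma card_extend k n (T : {fset nat}) : 0 < k ->
  T \in admissible k n -> #|` extend k T| = #|` T|.+1.
Proof. by move=> k0 TA; rewrite cardfsU1 (extend_notin k0 TA) card_shift. Qed.

(** The size of the image determines the size of the argument, hence the added element, which can
    then be removed. *)
Lemma extend_inj k n : 0 < k -> {in admissible k n &, injective (extend k)}.
Proof.
move=> k0 T U TA UA eqTU.
have eq_card : #|` T| = #|` U|.
  by apply: succn_inj; rewrite -(card_extend k0 TA) -(card_extend k0 UA) eqTU.
apply: (can_inj (shiftK k.+1)).
rewrite -(fsetU1K (extend_notin k0 TA)) -(fsetU1K (extend_notin k0 UA)).
by rewrite -!/(extend _ _) eqTU eq_card.
Qed.

Lemma shift_admissible k n (S : {fset nat}) :
  S \in admissible k n -> shift 1 S \in admissible k n.+1.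
Proof.
case/admissibleP=> Sk nS Sn Ss; apply/admissibleP; split.
- move=> x y; rewrite !mem_shift => /andP[x1 xS] /andP[y1 yS] xy.
  have := Sk _ _ xS yS; lia.
- by rewrite mem_shift subn1.
- move=> x; rewrite mem_shift => /andP[x1 /Sn]; lia.
- move=> x; rewrite mem_shift card_shift => /andP[x1 /Ss]; lia.
Qed.

Lemma extend_admissible k n (T : {fset nat}) : 0 < k ->
  T \in admissible k n -> extend k T \in admissible k (n + k.+1).
Proof.
move=> k0 TA; have cT := card_extend k0 TA.
case/admissibleP: TA => Tk nT Tn Ts; apply/admissibleP; split.
- move=> x y; rewrite !inE !mem_shift.
  case/orP=> [/eqP->|/andP[x1 xT]] /orP[/eqP->|/andP[y1 yT]] xy; try lia.
  + have := Ts _ yT; lia.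
  + have := Ts _ xT; lia.
  + have := Tk _ _ xT yT; lia.
- by rewrite !inE mem_shift leq_addl addnK nT orbT.
- move=> x; rewrite !inE mem_shift => /orP[/eqP->|/andP[x1 /Tn]]; last lia.
  have := Ts _ nT; lia.
- move=> x; rewrite cT !inE mem_shift => /orP[/eqP->|/andP[x1 /Ts]]; lia.
Qed.

(** All elements exceed [#|] S|[; if]#|[S|.+1] is absent, they still do after subtracting 1. *)
Lemma admissible_shift k n (S : {fset nat}) :
  S \in admissible k n.+1 -> #|` S|.+1 \notin S ->
  S \in shift 1 @` admissible k n.
Proof.
case/admissibleP=> Sk nS Sn Ss sS.
have s_lt x : x \in S -> #|` S|.+1 < x.
  by move=> xS; rewrite ltn_neqAle Ss // andbT; apply: contraNneq sS => ->.
have SE : shift 1 (unshift 1 S) = S.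
  by apply: unshiftK => x /s_lt; lia.
have memU x : (x \in unshift 1 S) = (x.+1 \in S).
  by rewrite -{2}SE mem_shift subn1.
apply/imfsetP; exists (unshift 1 S) => //=; apply/admissibleP.
rewrite -(card_shift 1) SE; split.
- by move=> x y; rewrite !memU => xS yS xy; have := Sk _ _ xS yS; lia.
- by rewrite memU.
- by move=> x; rewrite memU => /Sn.
- by move=> x; rewrite memU => /s_lt.
Qed.

Lemma admissible_extend k n (S : {fset nat}) : 0 < k ->
  S \in admissible k (n + k.+1) -> #|` S|.+1 \in S -> #|` S| != 1 ->
  S \in extend k @` admissible k n.
Proof.
move=> k0 /admissibleP[Sk nS Sn Ss] sS s1.
pose S' := S `\ #|` S|.+1.
have cS : #|` S| = #|` S'|.+1 by rewrite (cardfsD1 #|` S|.+1) sS.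
have S'_gt x : x \in S' -> #|` S|.+1 + k <= x.
  rewrite !inE => /andP[xs xS]; have := Ss _ xS; have := Sk _ _ sS xS; lia.
have S'S x : x \in S' -> x \in S by rewrite !inE => /andP[].
have SE : shift k.+1 (unshift k.+1 S') = S'.
  by apply: unshiftK => x /S'_gt; lia.
have memU x : (x \in unshift k.+1 S') = (x + k.+1 \in S').
  by rewrite -{2}SE mem_shift leq_addl addnK.
have cU : #|` unshift k.+1 S'| = #|` S'| by rewrite -(card_shift k.+1) SE.
apply/imfsetP; exists (unshift k.+1 S') => /=; last first.
  by rewrite /extend SE cU addn2 -cS fsetD1K.
apply/admissibleP; rewrite cU; split.
- move=> x y; rewrite !memU => /S'S xS /S'S yS xy; have := Sk _ _ xS yS; lia.
- have /fset0Pn[x xS'] : S' != fset0 by rewrite -cardfs_gt0; lia.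
  rewrite memU !inE nS andbT.
  by have := Sn _ (S'S _ xS'); have := S'_gt _ xS'; have := Ss _ sS; lia.
- move=> x; rewrite memU => /S'S /Sn; lia.
- move=> x; rewrite memU => /S'_gt; lia.
Qed.

Lemma admissible_card1 k n (S : {fset nat}) :
  S \in admissible k n -> #|` S| = 1 -> S = [fset n].
Proof.
case/admissibleP=> _ nS _ _ /eqP/cardfs1P[x Sx].
by move: nS; rewrite Sx inE => /eqP->.
Qed.

Lemma admissible_rec k n : 0 < k -> 0 < n ->
  admissible k (n + k.+1) =
    shift 1 @` admissible k (n + k) `|` extend k @` admissible k n.
Proof.
move=> k0 n0; apply/fsetP => S; rewrite in_fsetU; apply/idP/orP; last first.
  case=> /imfsetP[T /= TA ->]; last exact: extend_admissible.
  by rewrite addnS; apply: shift_admissible.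
move=> SA; case: (boolP (#|` S|.+1 \in S)) => [sS|sS].
  (* If [S] had size 1, it would be the singleton of [n + k.+1] and contain 2, forcing
     [n + k = 1]. *)
  right; apply: admissible_extend => //; apply/eqP => s1.
  by move: sS; rewrite s1 (admissible_card1 SA s1) inE; lia.
by left; apply: admissible_shift => //; rewrite -addnS.
Qed.

(** Size plus one separates the images: it belongs to every extended set, while all elements of a
    set shifted by 1 exceed it. *)
Lemma shift_extend_disjoint k m n : 0 < k ->
  [disjoint shift 1 @` admissible k m & extend k @` admissible k n]%fset.
Proof.
move=> k0; apply/fdisjointP => _ /imfsetP[S /= /admissibleP[_ _ _ Ss] ->].
apply/imfsetP => -[T /= TA eqST]; have := card_extend k0 TA.
rewrite -eqST card_shift => cS.
have : #|` T| + 2 \in shift 1 S by rewrite eqST fset1U1.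
by rewrite mem_shift => /andP[_ /Ss]; lia.
Qed.

Lemma I_count_rec k n : 0 < k -> 0 < n ->
  I_count k (n + k.+1) = I_count k (n + k) + I_count k n.
Proof.
move=> k0 n0; rewrite /I_count -!/(admissible _ _) admissible_rec //.
rewrite cardfsU disjoint_fsetI0 ?shift_extend_disjoint // cardfs0 subn0.
congr (_ + _).
  by rewrite card_imfset //; apply: can_inj (shiftK 1).
by rewrite card_in_imfset //=; apply: extend_inj.
Qed.

Lemma I_count1 k : I_count k 1 = 0.
Proof.
apply/eqP; rewrite /I_count -/(admissible k 1) cardfs_eq0; apply/eqP/fsetP => S.
rewrite inE; apply/negP => /admissibleP[_ S1 _ /(_ _ S1)].
by rewrite ltnS leqn0 cardfs_eq0 => /eqP S0; rewrite S0 inE in S1.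
Qed.

(** Only the singleton of [n] qualifies: with a second element [x] the size is at least 2, so
    [x >= 3] and [n >= x + k >= k + 3]. *)
Lemma I_count_small k n : 1 < n <= k + 2 -> I_count k n = 1.
Proof.
case/andP=> n1 nk; rewrite /I_count -/(admissible k n).
suff -> : admissible k n = [fset [fset n]] by rewrite cardfs1.
apply/fsetP => S; rewrite inE; apply/idP/eqP => [SA|->]; last first.
  apply/admissibleP; split; rewrite ?inE // => x.
  - by move=> y; rewrite !inE => /eqP-> /eqP->; rewrite ltnn.
  - by rewrite inE => /eqP->.
  - by rewrite inE cardfs1 => /eqP->.
case/admissibleP: (SA) => Sk nS Sn Ss; apply: (admissible_card1 SA).
have cS : #|` S| = #|` S `\ n|.+1 by rewrite (cardfsD1 n) nS.
suff S0 : S `\ n = fset0 by rewrite cS S0 cardfs0.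
apply/eqP/negPn/negP => S'0; have /fset0Pn[x] := S'0.
rewrite -cardfs_gt0 in S'0; rewrite !inE => /andP[xn xS].
by have := Ss _ xS; have := Sn _ xS; have := Sk _ _ xS nS; lia.
Qed.

Theorem theorem5 (k n : nat) (hk : 2 <= k) (hn : 1 <= n) :
  I_count k n =
    if n == 1 then 0
    else if n <= k + 2 then 1
    else I_count k (n - 1) + I_count k (n - (k + 1)).
Proof.
case: eqVneq => [->|n1]; first exact: I_count1.
case: leqP => nk; first by apply: I_count_small; lia.
(* As [n > k + 2], both subtractions are exact and [n - (k + 1)] is positive. *)
have nE : n = (n - (k + 1)) + k.+1 by lia.
have nE1 : n - 1 = (n - (k + 1)) + k by lia.
by rewrite nE1 {1}nE I_count_rec; lia.
Qed.
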